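(* Let $\epsilon>0$, let $G$ be a finite soluble group and let $T=\gamma_\infty(G)$. Assume that for every $p\in\pi(T)$ there is a Sylow $p$-subgroup $P$ of $T$ and a Hall $p'$-subgroup $H$ of $G$ such that $\Pr(P,H)\ge\epsilon$. Then the exponent of $G/F(G)$ is $\epsilon$-bounded.
   Context: For subsets $X,Y$ of a finite group, $\Pr(X,Y)=\frac{|\{(x,y)\in X\times Y : xy=yx\}|}{|X||Y|}$. $\pi(T)$ is the set of primes dividing $|T|$. $\gamma_\infty(G)$ is the intersection of all terms of the lower central series of $G$. $F(G)$ is the Fitting subgroup of $G$. A Hall $p'$-subgroup of $G$ is a subgroup of order prime to $p$ whose index in $G$ is a power of $p$. The exponent of a finite group is the least positive integer $e$ with $x^e=1$ for all elements $x$. ''$\epsilon$-bounded'' means bounded above by a number depending only on $\epsilon$. *)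

(* Defs.v *)
From HB Require Import structures.
From mathcomp Require Export all_boot all_order all_algebra all_fingroup.
From mathcomp Require Export all_solvable.
From mathcomp Require Export boolp reals.
Set Implicit Arguments.
Unset Strict Implicit.
Unset Printing Implicit Defensive.
Import Order.TTheory GRing.Theory Num.Theory.

Section Defs.
Variable gT : finGroupType.
Local Open Scope group_scope.

(* The terms of the lower central series are 'L_1(G) = G, 'L_2(G) = [G, G],
   and so on, whence the index shift. *)
Definition gamma_infty (G : {set gT}) : {set gT} :=
  [set x | `[< forall n : nat, x \in 'L_n.+1(G) >]].

Lemma gamma_infty_group_set (G : {group gT}) : group_set (gamma_infty G).
Proof.
apply/group_setP; split=> [|x y].
  by rewrite inE; apply/asboolP=> n; apply: group1.
rewrite !inE => /asboolP Lx /asboolP Ly; apply/asboolP=> n.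
by rewrite groupM ?Lx ?Ly.
Qed.

Canonical gamma_infty_group (G : {group gT}) :=
  Group (gamma_infty_group_set G).

End Defs.

Definition commuting_prob (R : realType) (gT : finGroupType) (X Y : {set gT})
    : R :=
  (#|[set u in setX X Y | (u.1 * u.2 == u.2 * u.1)%g]|%:R
     / (#|X|%:R * #|Y|%:R))%R.

(* Main.v *)
(* Fix a prime [r] and an [r]'-element [h] of prime power order lying in the
   given Hall [r]'-subgroup [H], and work modulo [O_r'(G)].  There [F(G)] is the
   [r]-group [V = O_r(G)], so [C = <h>] acts faithfully on [V] and, by
   coprimality, on [W = V :&: gamma_infty G], which lies in every Sylow
   [r]-subgroup of [gamma_infty G].  As [Pr] does not decrease when passing to
   quotients or to subgroups of either factor, [Pr(P, H) <= Pr(W, C)].  If [Z]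
   is the minimal subgroup of [C] and [U = C_W(Z)], elements outside [U] have
   trivial stabiliser in [C], and [#|W : U| >= #|C|]; hence
   [Pr(W, C) <= 2 / #|C|], so [h] has order at most [2 / eps] modulo [O_r'(G)].
   Consequently a power of bounded exponent of any [p]-element lies in [O_r'(G)]
   for all [r != p], and the intersection of these cores is a normal
   [p]-subgroup, contained in [F(G)]. *)
Require Import Defs.
Import Order.TTheory GRing.Theory Num.Theory.
Local Open Scope ring_scope.

(** * Monotonicity of the commuting probability *)

Lemma commuting_probE (R : realType) (gT : finGroupType) (X Y : {set gT}) :
  commuting_prob R X Y
    = (\sum_(x in X) \sum_(y in Y) (x * y == y * x)%g)%N%:R
        / (#|X|%:R * #|Y|%:R).
Proof.
congr (_%:R / _); rewrite pair_big_dep /= -sum1dep_card big_mkcond.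
rewrite [RHS]big_mkcond /=; apply: eq_bigr => -[x y] _.
by rewrite !inE /=; do 2!case: (_ \in _) => //=; case: (_ == _).
Qed.

Section CommutingProbability.
Variables (R : realType) (gT : finGroupType).
Local Open Scope group_scope.
Implicit Types X Y N : {group gT}.

Lemma commuting_probC (X Y : {set gT}) :
  commuting_prob R X Y = commuting_prob R Y X.
Proof.
rewrite !commuting_probE exchange_big /=.
rewrite [(#|X|%:R * _)%R]mulrC; congr (_%:R / _)%R.
by apply: eq_bigr => y _; apply: eq_bigr => x _; rewrite eq_sym.
Qed.

Lemma sum_cent1E (X Y : {set gT}) :
  (\sum_(x in X) \sum_(y in Y) (x * y == y * x)%g)%N
    = (\sum_(x in X) #|'C_Y[x]|)%N.
Proof.
apply: eq_bigr => x _; rewrite -sum1_card big_mkcond [RHS]big_mkcond /=.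
apply: eq_bigr => y _; rewrite in_setI (sameP cent1P eqP) /commute.
by rewrite eq_sym; case: (y \in Y); case: (_ == _).
Qed.

(** For each [x], the set ['C_Y[x] * Y0] lies in [Y], so the proportion of [Y0] centralising [x] is
    at least that of [Y]. *)
Lemma commuting_prob_subr X Y (Y0 : {group gT}) :
  Y0 \subset Y -> (commuting_prob R X Y <= commuting_prob R X Y0)%R.
Proof.
move=> sY0Y; rewrite !commuting_probE !sum_cent1E.
have gt0 (A : {group gT}) : (0 < #|A|%:R :> R)%R by rewrite ltr0n.
rewrite ler_pdivrMr ?mulr_gt0 // mulrAC ler_pdivlMr ?mulr_gt0 //.
rewrite -!natrM ler_nat mulnCA [leqRHS]mulnCA leq_mul2l; apply/orP; right.
rewrite !big_distrl /=; apply: leq_sum => x _.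
rewrite mul_cardG -setIA (setIC 'C[x]) setIA (setIidPr sY0Y) mulnC.
by rewrite leq_mul2l subset_leq_card ?orbT // mul_subG ?subsetIl.
Qed.

Lemma commuting_prob_subl X Y (X0 : {group gT}) :
  X0 \subset X -> (commuting_prob R X Y <= commuting_prob R X0 Y)%R.
Proof.
by rewrite commuting_probC (commuting_probC X0); apply: commuting_prob_subr.
Qed.

Lemma sum_coset X N (F : coset_of N -> nat) : X \subset 'N(N) ->
  (\sum_(x in X) F (coset N x) = #|X :&: N| * \sum_(b in X / N) F b)%N.
Proof.
move=> nNX; rewrite (partition_big (coset N) (mem (X / N))) /=; last first.
  by move=> x Xx; apply: mem_quotient.
rewrite big_distrr; apply: eq_bigr => _ /morphimP[x0 Nx0 Xx0 ->].
rewrite (eq_bigr (fun=> F (coset N x0))) => [|x /andP[_ /eqP->]//].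
rewrite sum_nat_const; congr (_ * _)%N; rewrite -(card_lcoset _ x0).
apply: eq_card => x; rewrite mem_lcoset !inE.
rewrite unfold_in /= groupMl ?groupV //; case: (boolP (x \in X)) => //= Xx.
have Nx := subsetP nNX _ Xx.
have cosetVM : coset N (x0^-1 * x) = (coset N x0)^-1 * coset N x.
  by rewrite morphM ?groupV // morphV.
apply/eqP/idP => [e | /coset_id].
  by apply: coset_idr; rewrite ?groupM ?groupV // cosetVM e mulVg.
by rewrite cosetVM => /(canRL (mulKVg _)); rewrite mulg1.
Qed.

(** Commuting pairs map to commuting pairs, and all fibres on pairs have size
    [#|X :&: N| * #|Y :&: N|]. *)
Lemma commuting_prob_quotient X Y N :
    X \subset 'N(N) -> Y \subset 'N(N) ->
  (commuting_prob R X Y <= commuting_prob R (X / N)%g (Y / N)%g)%R.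
Proof.
move=> nNX nNY; rewrite !commuting_probE.
have gt0 (rT : finGroupType) (A : {group rT}) : (0 < #|A|%:R :> R)%R.
  by rewrite ltr0n.
rewrite ler_pdivrMr ?mulr_gt0 ?gt0 // mulrAC ler_pdivlMr ?mulr_gt0 ?gt0 //.
rewrite -!natrM ler_nat.
have oQ (A : {group gT}) : A \subset 'N(N) -> #|A| = (#|A :&: N| * #|(A / N)%g|)%N.
  by move=> nNA; rewrite card_quotient // LagrangeI.
rewrite (oQ X nNX) (oQ Y nNY) mulnACA [leqRHS]mulnA leq_mul2r; apply/orP; right.
rewrite mulnC -mulnA big_distrr -sum_coset //=; apply: leq_sum => x Xx.
rewrite -sum_coset //=; apply: leq_sum => y Yy.
case: eqP => // exy; rewrite -!morphM ?(subsetP nNX _ Xx) ?(subsetP nNY _ Yy) //=.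
by rewrite exy eqxx.
Qed.

End CommutingProbability.

(** * Coprime action, the Fitting subgroup and cores *)

Section Groups.
Variable gT : finGroupType.
Local Open Scope group_scope.

(** As [s] commutes with [[~ v, s]], the power [[~ v, s] ^+ #[s]] equals [[~ v, s ^+ #[s]] = 1],
    while [[~ v, s]] lies in [V]. *)
Lemma coprime_commg_eq1 (V : {group gT}) v s :
    v \in V -> s \in 'N(V) -> coprime #|V| #[s] -> commute s [~ v, s] ->
  [~ v, s] = 1.
Proof.
move=> Vv nVs co cs; apply/eqP.
have Vc : [~ v, s] \in V by rewrite groupM ?groupV ?memJ_norm.
rewrite -order_eq1 -dvdn1 -(eqP co) dvdn_gcd order_dvdG //=.
by rewrite order_dvdn -commgX // expg_order commg1.
Qed.

(** Climb the derived series of [C]: if the derived subgroup of a term [M] lies in ['F(G)], then [M]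
    centralises it, so [M] is nilpotent of class at most 2. *)
Lemma sub_cent_Fitting (G : {group gT}) : solvable G -> 'C_G('F(G)) \subset 'F(G).
Proof.
move=> solG; set C := 'C_G('F(G)).
have nCG : C <| G.
  by rewrite /normal subsetIl normsI ?normG // norms_cent ?gFnorm.
have /derivedP[n Cn] := solvableS (subsetIl G _) solG : solvable C.
have: C^`(n) \subset 'F(G) by rewrite Cn sub1G.
elim: n {Cn} => // n IHn sCF; apply: IHn.
have sMC : C^`(n) \subset C := der_sub n C.
apply: Fitting_max; first by apply: gFnormal_trans.
apply/lcnP; exists 2; apply/commG1P.
rewrite (subset_trans sCF) // centsC.
exact: subset_trans sMC (subsetIr _ _).
Qed.

Lemma sum_cent1_coprime_leq (W : {group gT}) (q : nat) g :
    g \in 'N(W) -> q.-elt g -> coprime #|W| #[g] ->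
    'C_<[g]>(W) = 1 ->
  (\sum_(w in W) #|'C_<[g]>[w]| <= 2 * #|W|)%N.
Proof.
move=> nWg qg co faithful.
have [-> | ntg] := eqVneq g 1.
  rewrite cycle1 -sum1_card big_distrr /=; apply: leq_sum => w _.
  by rewrite (leq_trans (subset_leq_card (subsetIl _ _))) ?cards1.
set C := <[g]>; pose Z := 'Ohm_1(C)%G; pose U := 'C_W(Z)%G.
have nWC : C \subset 'N(W) by rewrite cycle_subG.
have oZ (S : {group gT}) : S \subset C -> S :!=: 1 -> #|'Ohm_1(S)| = q.
  move=> sSC ntS; apply: Ohm1_cyclic_pgroup_prime ntS.
    exact: cyclicS sSC (cycle_cyclic g).
  exact: pgroupS sSC qg.
have sZ (S : {group gT}) : S \subset C -> S :!=: 1 -> Z \subset S.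
  move=> sSC ntS; have/eqP <-: 'Ohm_1(S) == Z; last exact: Ohm_sub.
  by rewrite eqEcard OhmS //= !oZ // cycle_eq1.
have sZC : Z \subset C by apply: Ohm_sub.
have ZP w z : w \in W -> z \in Z -> commute z [~ w, z] -> [~ w, z] = 1.
  move=> Ww Zz; have Cz := subsetP sZC z Zz.
  apply: (coprime_commg_eq1 W) => //; first exact: (subsetP nWC).
  by apply: coprime_dvdr co; apply: order_dvdG.
have ntZ : Z :!=: 1 by rewrite Ohm1_eq1 cycle_eq1.
have regular w : w \in W :\: U -> 'C_C[w] = 1.
  case/setDP=> Ww; apply: contraNeq => ntS.
  rewrite inE Ww -sub1set centsC.
  by rewrite (subset_trans (sZ _ (subsetIl _ _) ntS)) // cent_set1 subsetIr.
have [w /setDP[Ww U'w]] : exists w, w \in W :\: U.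
  apply/set0Pn; rewrite setD_eq0; apply: contra ntZ => sWU.
  rewrite -subG1 -faithful subsetI sZC centsC (subset_trans sWU) //.
  exact: subsetIr.
have nUC : C \subset 'N(U).
  by rewrite normsI // norms_cent // gFnorm.
(* Each coset of [U] in [W] other than [U] itself has a regular [C]-orbit. *)
have leUC : (#|U| * #|C| <= #|W|)%N.
  rewrite -(LagrangeI W U) /= setIA setIid leq_mul2l; apply/orP; right.
  rewrite -card_lcosets -/U.
  have <-: #|orbit 'Js C (w *: U)| = #|C|.
    rewrite card_orbit; set S := 'C_C[_ | _].
    suff ->: S = 1 by rewrite indexg1.
    (* If [Z] fixes [w *: U], then [[~ w, z]] lies in [U], so it commutes with [z] and is trivial,
       which puts [w] in [U]. *)
    apply/eqP/negPn/negP=> /(sZ _ (subsetIl _ _)) sZS.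
    case/negP: U'w; rewrite inE Ww; apply/centP=> z Zz.
    apply/commgP/eqP/ZP => //; apply/esym/(centP _ z Zz).
    have /setIP[_ /astab1P /= nz] := subsetP sZS z Zz.
    have: w ^ z \in w *: U by rewrite -nz memJ_conjg lcoset_refl.
    by rewrite mem_lcoset => /setIP[].
  apply/subset_leq_card/subsetP=> _ /imsetP[c Cc ->].
  apply/lcosetsP; exists (w ^ c); first by rewrite memJ_norm // (subsetP nWC).
  by rewrite /= conjsMg conjg_set1 (normsP nUC).
rewrite (bigID (mem U)) /= mul2n -addnn leq_add //.
  apply: leq_trans leUC; rewrite (eq_bigl (mem U)) /= => [|x].
    rewrite -sum_nat_const.
    by apply: leq_sum => x _; rewrite subset_leq_card ?subsetIl.
  by apply: andb_idl => /setIP[].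
rewrite -sum1_card big_mkcondr /=; apply: leq_sum => x Wx; case: ifP => //= U'x.
by rewrite regular ?cards1 // inE U'x.
Qed.

(** The normal closure of [y] lies in all these cores, so no prime other than [p] divides its
    order. *)
Lemma mem_pcore_p'cores (G : {group gT}) p y :
    y \in G -> (forall r, prime r -> r != p -> y \in 'O_r^'(G)) ->
  y \in 'O_p(G).
Proof.
move=> Gy p'cores.
have: <<y ^: G>> \subset 'O_p(G).
  apply: pcore_max; last first.
    by rewrite /normal gen_subG class_subG //= norms_gen ?class_norm.
  apply/pgroupP=> r pr_r; apply: contraTT; rewrite inE /= => neq_rp.
  rewrite -p'natE //; apply: pgroupS (pcore_pgroup r^' G).
  by rewrite gen_subG class_sub_norm ?gFnorm ?p'cores.
by move/subsetP; apply; rewrite mem_gen ?class_refl.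
Qed.

(** An element is the product of its commuting [p]-constituents, so elements of prime power order
    suffice. *)
Lemma exponent_quotient_dvd (G N : {group gT}) n :
    G \subset 'N(N) ->
    (forall p g, prime p -> g \in G -> p.-elt g -> g ^+ n \in N) ->
  (exponent (G / N) %| n)%N.
Proof.
move=> nNG Np; apply/exponentP=> _ /morphimP[x Nx Gx ->].
rewrite -morphX //; apply: coset_id; rewrite -(prod_constt (x ^+ _)).
apply: group_prod => p _; rewrite consttX.
have [pr_p | np_p] := boolP (prime p).
  by rewrite (Np p) ?p_elt_constt ?groupX.
suff ->: x.`_p = 1 by rewrite expg1n.
by apply/eqP; rewrite -order_eq1 order_constt p_part lognE (negPf np_p).
Qed.

(** Each [x] outside [gamma_infty G] has left the decreasing series by some index [f x]; the largest
    one serves for all. *)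
Lemma gamma_infty_lcn (G : {group gT}) : exists n, gamma_infty G = 'L_n.+1(G).
Proof.
have /choice[f fP] (x : gT) : exists n, x \in 'L_n.+1(G) -> x \in gamma_infty G.
  have [Tx | T'x] := boolP (x \in gamma_infty G); first by exists 0%N.
  move: T'x; rewrite inE => /asboolPn/existsNP[n T'x].
  by exists n.
exists (\max_x f x); apply/setP=> x; apply/idP/idP => [|Lx].
  by rewrite inE => /asboolP.
by apply/fP/(subsetP (lcn_sub_leq _ _) x Lx)/leq_bigmax.
Qed.

End Groups.

(** * Orders modulo the [r']-core *)

Section OrderModuloCore.
Local Open Scope group_scope.

Lemma order_coset_pcore_leq (R : realType) (gT : finGroupType)
    (G P H : {group gT}) (r q : nat) h :
    solvable G -> r.-Sylow(gamma_infty G) P ->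
    H \subset G -> r^'.-group H -> h \in H -> q.-elt h ->
  (#[coset 'O_r^'(G) h]%:R * commuting_prob R P H <= 2)%R.
Proof.
move=> solG sylP sHG r'H Hh qh; set N := 'O_r^'(G)%G.
have [n defT] := gamma_infty_lcn _ G.
have nTG : gamma_infty G <| G by rewrite defT lcn_normal.
have nNG : G \subset 'N(N) by apply: gFnorm.
have sPG : P \subset G := subset_trans (pHall_sub sylP) (normal_sub nTG).
have nNh : h \in 'N(N) by rewrite (subsetP nNG) ?(subsetP sHG).
set g := coset N h; set C := <[g]>; set V := 'O_r(G / N)%G.
(* A fixed term replaces [gamma_infty] because lower central terms map onto those of the
   quotient. *)
set W := (V :&: 'L_n.+1(G / N))%G.
have sCG : C \subset G / N.
  by rewrite cycle_subG mem_quotient // (subsetP sHG).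
have nVC : C \subset 'N(V) by rewrite (subset_trans sCG) ?gFnorm.
have sWV : W \subset V by apply: subsetIl.
have nWG : W <| G / N by rewrite normalI ?pcore_normal ?lcn_normal.
have rV : r.-group V by apply: pcore_pgroup.
have r'C : r^'.-group C.
  by rewrite /C -quotient_cycle // quotient_pgroup // (pgroupS _ r'H) // cycle_subG.
have coVC : coprime #|V| #|C| by apply: pnat_coprime rV r'C.
(* [G / N] has trivial [r']-core, so its Fitting subgroup is [V], which contains its own centraliser
   and meets [C] trivially. *)
have faithV : 'C_C(V) = 1.
  have defF : 'F(G / N) = V.
    by apply: Fitting_eq_pcore; apply: trivg_pcore_quotient.
  apply/trivgP; rewrite -(coprime_TIg coVC) subsetI subsetIl andbT.
  rewrite -defF (subset_trans _ (sub_cent_Fitting _ _ _)) ?quotient_sol //.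
  by rewrite defF setSI.
have faithW : 'C_C(W) = 1.
  (* [C_C(W)] stabilises the series of the [V :&: 'L_k.+1(G / N)], so it
     centralises [V] by coprimality. *)
  apply/trivgP; rewrite -faithV subsetI subsetIl; set S := 'C_C(W).
  have sSC : S \subset C by apply: subsetIl.
  have: S \subset 'C(V :&: 'L_n.+1(G / N)) by apply: subsetIr.
  elim: (n) => [|k IHk] cS.
    by rewrite lcn1 (setIidPl (pcore_sub _ _)) in cS.
  apply: IHk; rewrite centsC; apply/centsP=> v /setIP[Vv Lv] s Ss.
  have Cs := subsetP sSC s Ss; apply/commgP/eqP.
  apply: (coprime_commg_eq1 _ V) => //; first exact: (subsetP nVC).
    by apply: coprime_dvdr coVC; apply: order_dvdG.
  apply: (centsP cS) => //; rewrite inE lcnSn mem_commg ?(subsetP sCG) //.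
  by rewrite groupM ?groupV // memJ_norm // (subsetP nVC).
(* [W] is a normal [r]-subgroup of [gamma_infty G / N], hence lies in each of its Sylow
   [r]-subgroups. *)
have sWP : W \subset P / N.
  have sylPN : r.-Sylow(gamma_infty G / N) (P / N).
    by rewrite quotient_pHall // (subset_trans sPG).
  apply: subset_trans (pcore_sub_Hall sylPN); apply: pcore_max.
    exact: pgroupS sWV rV.
  apply: (normalS _ _ nWG); last exact: quotientS (normal_sub nTG).
  by rewrite /= defT /quotient morphim_lcn //; apply: subsetIr.
have sCH : C \subset H / N by rewrite cycle_subG mem_quotient.
have := commuting_prob_quotient R _ P H N (subset_trans sPG nNG) (subset_trans sHG nNG).
move=> /le_trans/(_ (commuting_prob_subl R _ _ _ _ sWP)).
move=> /le_trans/(_ (commuting_prob_subr R _ _ _ _ sCH)).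
rewrite [leRHS]commuting_probE sum_cent1E => lePr.
have gt0 (rT : finGroupType) (A : {group rT}) : (0 < #|A|%:R :> R)%R.
  by rewrite ltr0n.
rewrite mulrC -ler_pdivlMr ?gt0 //; apply: le_trans lePr _.
rewrite ler_pdivrMr ?mulr_gt0 ?gt0 // mulrCA divfK ?gt_eqF ?gt0 //.
rewrite -natrM ler_nat mulnC; apply: (sum_cent1_coprime_leq _ _ q) => //.
- by rewrite -cycle_subG (subset_trans sCG) ?normal_norm.
- exact: morph_p_elt.
- exact: coprimeSg sWV coVC.
Qed.

End OrderModuloCore.

Theorem lemma3p4 (R : realType) (eps : R) (eps_gt0 : 0 < eps) :
  exists N : nat, forall (gT : finGroupType) (G : {group gT}),
    solvable G ->
    (forall p : nat, p \in \pi(gamma_infty G) ->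
       exists P H : {group gT},
         [/\ (p.-Sylow(gamma_infty G) P)%g, (p^'.-Hall(G) H)%g
           & eps <= commuting_prob R P H]) ->
    (exponent (G / 'F(G))%g <= N)%N.
Proof.
(* The 2 serves the primes not dividing [#|gamma_infty G|], where commuting probability 1 bounds
   orders by 2. *)
pose B := maxn 2 (Num.bound (2 / eps)).
have ltB n : n%:R * eps <= 2 -> (n <= B)%N.
  rewrite -ler_pdivlMr // => le_n; rewrite leq_max; apply/orP; right.
  by rewrite -(ler_nat R) ltW // (le_lt_trans le_n) // archi_boundP // divr_ge0 // ltW.
(* The factorial is a common multiple of all orders up to [B]. *)
exists B`!%N; move=> gT G solG hypG; rewrite dvdn_leq ?fact_gt0 //.
have order_coset (p r : nat) g : prime r -> p != r -> g \in G ->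
    (p.-elt g)%g -> (#[coset 'O_r^'(G) g]%g <= B)%N.
  move=> pr_r neq_pr Gg pg.
  have [P [H [sylP hallH lePr]]] : exists P H : {group gT},
      [/\ (r.-Sylow(gamma_infty G) P)%g, (r^'.-Hall(G) H)%g
        & forall n, n%:R * commuting_prob R P H <= 2 -> (n <= B)%N].
    have [T_r | T'r] := boolP (r \in \pi(gamma_infty G)).
      have [P [H [sylP hallH lePr]]] := hypG r T_r; exists P, H; split=> // n le_n.
      by apply: ltB; apply: le_trans le_n; rewrite ler_wpM2l.
    (* For [r] prime to [gamma_infty G] the hypothesis says nothing, but the
       trivial Sylow subgroup has commuting probability [1]. *)
    have [H hallH] := Hall_exists r^' solG.
    exists 1%G, H; split=> // [|n].
      rewrite pHallE sub1G cards1 eq_sym partn_eq1 //= p'natE //.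
      by apply: contra T'r => T_r; rewrite mem_primes pr_r cardG_gt0.
    rewrite commuting_probE sum_cent1E big_set1 cent11T setIT cards1 mul1r.
    rewrite divff ?pnatr_eq0 -?lt0n // mulr1 (ler_nat _ _ 2) => le_n2.
    by rewrite (leq_trans le_n2) // leq_maxl.
  (* Some conjugate of the [r']-element [g] lies in [H], and conjugation preserves its order modulo
     the core. *)
  have [||x Gx sgH] := Hall_Jsub solG hallH (_ : <[g]> \subset G)%g.
  - by rewrite cycle_subG.
  - by apply: sub_p_elt pg => t /eqnP->; rewrite !inE.
  have Hgx : (g ^ x)%g \in H by rewrite -cycle_subG cycleJ.
  have nN y : y \in G -> y \in 'N('O_r^'(G))%g.
    by apply/subsetP; apply: gFnorm.
  rewrite -(orderJ _ (coset 'O_r^'(G) x)) -morphJ ?nN //; apply: lePr.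
  apply: (order_coset_pcore_leq _ _ _ _ H _ p) => //.
  - exact: pHall_sub hallH.
  - exact: pHall_pgroup hallH.
  - by rewrite p_eltJ.
apply: exponent_quotient_dvd (gFnorm _ _) _ => p g pr_p Gg pg.
suff: (g ^+ B`!)%g \in 'O_p(G)%g.
  apply/subsetP; rewrite Fitting_max ?pcore_normal //.
  exact: pgroup_nil (pcore_pgroup p G).
have Ggn : (g ^+ B`!)%g \in G by rewrite groupX.
apply: mem_pcore_p'cores Ggn _ => r pr_r neq_rp.
have nNg : g \in 'N('O_r^'(G))%g by rewrite (subsetP (gFnorm _ _)).
apply: coset_idr; first by rewrite groupX.
apply/eqP; rewrite morphX // -order_dvdn dvdn_fact // order_gt0 /=.
by apply: (order_coset p); rewrite // eq_sym.
Qed.
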